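(* Let $n\ge 1$, let $S_1,\dots,S_n$ be the sets of (full) observations at $n$ sites, and let $p(i)$, $i\in\{1,\dots,n\}$, be the false-match probabilities of the partial observation. Then $$\hat t = X^*(\mathbf{A}_n)-\sum_{\mathbf{M}\succ\mathbf{A}_n}p(\#\mathbf{M})\,X(\mathbf{M})$$ (the sum being over $\mathbf{M}\in\mathcal{M}_n$ with $\mathbf{M}\succ\mathbf{A}_n$) is an unbiased estimator for $X(\mathbf{A}_n)$, i.e. $\mathrm{E}[\hat t\,]=X(\mathbf{A}_n)$.
   Context: There are $n$ observation sites; $S_i$ is the finite set of observations at site $i$, and $\mathcal{S}=S_1\times\cdots\times S_n$ is the set of all $n$-tuples of observations $\mathbf{y}=(y_1,\dots,y_n)$, $y_i\in S_i$. Observations from different sites may be compared for equality. $\mathcal{M}_n$ is the set of all partitions of $\{1,\dots,n\}$ into nonempty blocks, and $\#\mathbf{M}$ is the number of blocks of $\mathbf{M}$. For an $n$-tuple $\mathbf{w}$ (of full or of partial observations), $C(\mathbf{w})\in\mathcal{M}_n$ is the unique partition such that, for all $i,j$, $w_i=w_j$ if and only if $i$ and $j$ lie in the same block. $\mathbf{A}_n=\{\{1,\dots,n\}\}$ is the one-block partition. Partial order on $\mathcal{M}_n$: $\mathbf{M}\succsim\mathbf{M}'$ if and only if whenever $i,j$ lie in the same block of $\mathbf{M}$, they also lie in the same block of $\mathbf{M}'$ (so finer partitions are larger); $\mathbf{M}\succ\mathbf{M}'$ means $\mathbf{M}\succsim\mathbf{M}'$ and $\mathbf{M}\neq\mathbf{M}'$.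 Thus $\mathbf{M}\succ\mathbf{A}_n$ holds for every $\mathbf{M}\neq\mathbf{A}_n$. Each $\mathbf{y}\in\mathcal{S}$ gives rise to a partial observation $\mathbf{y}^*=(y_1^*,\dots,y_n^* )$, satisfying $(y_i=y_j)\Rightarrow(y_i^*=y_j^* )$ for all $i,j$. Whether distinct individuals coincide in the partial observation is random: $p(i)$, for $i\in\{1,\dots,n\}$, is the probability that, given that $i$ observed individuals are all different in the full observation, they are all the same in the partial observation. It is assumed that $p(i)$ does not depend on the sites at which the individuals are observed, and by convention $p(1)=1$. Consequently, for a tuple $\mathbf{y}\in\mathcal{S}$ with $C(\mathbf{y})=\mathbf{M}$ (which involves exactly $\#\mathbf{M}$ distinct individuals), the probability that $C(\mathbf{y}^* )=\mathbf{A}_n$ is $p(\#\mathbf{M})$. The full data $S_1,\dots,S_n$ are regarded as fixed and the expectation is over the randomness of the partial observations. Counting functions: $X(\mathbf{M})=\#\{\mathbf{y}\in\mathcal{S}: C(\mathbf{y})=\mathbf{M}\}$ is the exact matching count in the full data, and $X^*(\mathbf{M})=\#\{\mathbf{y}\in\mathcal{S}: C(\mathbf{y}^* )=\mathbf{M}\}$ is the corresponding count in the partial data. *)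

(* Defs.v *)
From HB Require Import structures.
From mathcomp Require Import all_boot all_order all_algebra.
From mathcomp Require Import finmap.
From mathcomp Require Import all_classical all_reals all_analysis.

Set Implicit Arguments.
Unset Strict Implicit.
Unset Printing Implicit Defensive.

Import Order.TTheory GRing.Theory Num.Theory.

Local Open Scope ring_scope.

Definition partitions (n : nat) : {set {set {set 'I_n}}} :=
  [set M | finset.partition M [set: 'I_n]].

Definition same_block (n : nat) (M : {set {set 'I_n}}) (i j : 'I_n) : bool :=
  [exists B in M, (i \in B) && (j \in B)].

(* Finer partitions are larger. *)
Definition finer (n : nat) (M M' : {set {set 'I_n}}) : bool :=
  [forall i, forall j, same_block M i j ==> same_block M' i j].

Definition strictly_finer (n : nat) (M M' : {set {set 'I_n}}) : bool :=
  finer M M' && (M != M').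

Definition one_block (n : nat) : {set {set 'I_n}} := [set [set: 'I_n]].

Definition coincidence (n : nat) (W : eqType) (w : 'I_n -> W) :
    {set {set 'I_n}} :=
  preim_partition w [set: 'I_n].

(* The observation sets live in a common type [U], so that observations from
   different sites can be compared. *)
Definition tuples (n : nat) (U : choiceType) (S : 'I_n -> {fset U}) : finType :=
  {dffun forall i : 'I_n, S i}.

Definition obs (n : nat) (U : choiceType) (S : 'I_n -> {fset U})
    (y : tuples S) (i : 'I_n) : U :=
  fsval (y i).

Definition match_count (n : nat) (U : choiceType) (S : 'I_n -> {fset U})
    (M : {set {set 'I_n}}) : nat :=
  #|[set y : tuples S | coincidence (obs y) == M]|.

(* [star y omega i] is the i-th entry of the partial observation of the tuple
   [y] under the outcome [omega]. *)
Definition partial_match_count (n : nat) (U : choiceType)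
    (S : 'I_n -> {fset U}) (Omega : Type) (V : eqType)
    (star : tuples S -> Omega -> 'I_n -> V) (M : {set {set 'I_n}})
    (omega : Omega) : nat :=
  #|[set y : tuples S | coincidence (star y omega) == M]|.

(* Only the pairwise coincidences of partial observations need to be events;
   no sigma-algebra on [V] is required. *)
Definition partial_observation (n : nat) (U : choiceType)
    (S : 'I_n -> {fset U}) (d : measure_display) (Omega : measurableType d)
    (V : eqType) (star : tuples S -> Omega -> 'I_n -> V) : Prop :=
  (forall (y : tuples S) (i j : 'I_n),
     measurable [set omega | star y omega i = star y omega j]%classic) /\
  (forall (y : tuples S) (omega : Omega) (i j : 'I_n),
     obs y i = obs y j -> star y omega i = star y omega j).

(* The individuals that [y] records at the sites of [I] are pairwise distinct;
   the probability that they all coincide in the partial observation depends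
   only on their number. The full data being fixed, the conditioning on
   distinctness is on a deterministic fact. *)
Definition false_match_probabilities (n : nat) (U : choiceType)
    (S : 'I_n -> {fset U}) (d : measure_display) (Omega : measurableType d)
    (R : realType) (P : probability Omega R) (V : eqType)
    (star : tuples S -> Omega -> 'I_n -> V) (p : nat -> R) : Prop :=
  p 1%N = 1 /\
  (forall (y : tuples S) (I : {set 'I_n}),
     I != finset.set0 -> {in I &, injective (obs y)} ->
     P [set omega | {in I &, forall i j, star y omega i = star y omega j}]%classic
       = (p #|I|)%:E).

Definition match_estimator (n : nat) (U : choiceType) (S : 'I_n -> {fset U})
    (Omega : Type) (R : realType) (V : eqType)
    (star : tuples S -> Omega -> 'I_n -> V) (p : nat -> R)
    (omega : Omega) : R :=
  (partial_match_count star (one_block n) omega)%:R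
  - \sum_(M in partitions n | strictly_finer M (one_block n))
      p #|M| * (match_count S M)%:R.

(* Integrability is required because the library's expectation is total. *)
Definition unbiased_estimator (d : measure_display) (Omega : measurableType d)
    (R : realType) (P : probability Omega R) (t : Omega -> R) (theta : R) :
    Prop :=
  P.-integrable [set: Omega]%classic (EFin \o t) /\ 'E_P[t]%E = theta%:E.

(* Main.v *)
(* The matching count of the partial data is a sum of indicators over the
   tuples [y], and each indicator has expectation [p #|C y|]: among the sites,
   choose one representative of every block of [C y]; the representatives are
   distinct individuals, and they all coincide in the partial observation if
   and only if all sites do. Grouping the tuples by the value of [C y] gives
   [\sum_M p #|M| * X M], where the one-block term is [p 1 * X A_n = X A_n] and
   the other terms are those subtracted in the estimator. *)

Require Import Defs.
From HB Require Import structures.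
From mathcomp Require Import all_boot all_order all_algebra.
From mathcomp Require Import finmap.
From mathcomp Require Import all_classical all_reals all_analysis.

Set Implicit Arguments.
Unset Strict Implicit.
Unset Printing Implicit Defensive.

Import Order.TTheory GRing.Theory Num.Theory.

Local Open Scope ring_scope.

Lemma pblock_coincidence (n : nat) (W : eqType) (w : 'I_n -> W) (i j : 'I_n) :
  (j \in finset.pblock (coincidence w) i) = (w i == w j).
Proof.
by apply: finset.pblock_equivalence_partition => // x y z _ _ _; split=> // /eqP->.
Qed.

(** Positivity of [n] matters: for [n = 0] the coincidence partition has no block, while
    [one_block 0] consists of the empty block. *)
Lemma coincidence_one_blockP (n : nat) (W : eqType) (w : 'I_n -> W) :
  (0 < n)%N ->
  reflect (forall i j, w i = w j) (coincidence w == one_block n).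
Proof.
move=> n_gt0; apply: (iffP eqP) => [Cw i j | w_const].
  apply/eqP; rewrite -pblock_coincidence Cw.
  by rewrite (finset.def_pblock (finset.trivIset1 _) (set11 _)) ?inE.
have blockT i : [set j in [set: 'I_n] | w i == w j] = [set: 'I_n].
  by apply/setP => j; rewrite !inE (w_const i j) eqxx.
apply/setP => B; rewrite inE; apply/imsetP/eqP => [[i _ ->] | ->].
  exact: blockT.
(* Some site is needed for the full set to arise as its class. *)
by exists (Ordinal n_gt0); rewrite ?inE ?blockT.
Qed.

(** A transversal of the coincidence partition serves as [I]: it meets each block exactly once, and
    two of its sites with equal values would share a block. *)
Lemma coincidence_representatives (n : nat) (W : eqType) (w : 'I_n -> W) :
  exists I : {set 'I_n},
    [/\ #|I| = #|coincidence w|, {in I &, injective w}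
      & forall i, exists2 j, j \in I & w i = w j].
Proof.
have partC : finset.partition (coincidence w) [set: 'I_n].
  exact: preim_partitionP.
have trI := transversalP partC.
have tiC := finset.partition_trivIset partC.
exists (transversal (coincidence w) [set: 'I_n]); split.
- exact: card_transversal trI.
- move=> i j iI jI wij; apply: (finset.pblock_inj trI) => //.
  by apply: esym; apply: finset.same_pblock; rewrite // pblock_coincidence wij.
- move=> i; have Bi : finset.pblock (coincidence w) i \in coincidence w.
    by rewrite finset.pblock_mem // (finset.cover_partition partC) inE.
  exists (transversal_repr i (transversal (coincidence w) [set: 'I_n])
            (finset.pblock (coincidence w) i)).
    exact: (repr_mem_transversal trI).
  by apply/eqP; rewrite -pblock_coincidence (repr_mem_pblock trI).
Qed.

(** Stating the event by pairwise equalities makes it a finite intersection of the events whose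
    measurability is assumed. *)
Definition all_coincide (n : nat) (Omega : Type) (V : eqType)
    (s : Omega -> 'I_n -> V) : set Omega :=
  [set omega | forall i j, s omega i = s omega j]%classic.

Lemma measurable_all_coincide (n : nat) (d : measure_display)
    (Omega : measurableType d) (V : eqType) (s : Omega -> 'I_n -> V) :
  (forall i j, measurable [set omega | s omega i = s omega j]%classic) ->
  measurable (all_coincide s).
Proof.
move=> ms.
have -> : all_coincide s =
    (\bigcap_(ij in [set: 'I_n * 'I_n])
       [set omega | s omega ij.1 = s omega ij.2])%classic.
  apply/seteqP; split=> [omega Cs [i j] _ | omega Cs i j]; first exact: Cs.
  exact: (Cs (i, j) I).
by apply: fin_bigcap_measurable => [|[i j] _]; [exact: finite_finset | exact: ms].
Qed.

Lemma probability_all_coincide (n : nat) (U : choiceType)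
    (S : 'I_n -> {fset U}) (d : measure_display) (Omega : measurableType d)
    (R : realType) (P : probability Omega R) (V : eqType)
    (star : tuples S -> Omega -> 'I_n -> V) (p : nat -> R) (y : tuples S) :
  (0 < n)%N -> partial_observation star ->
  false_match_probabilities P star p ->
  P (all_coincide (star y)) = (p #|coincidence (obs y)|)%:E.
Proof.
move=> n_gt0 [_ star_obs] [_ p_match].
have [J [<- obs_inj repJ]] := coincidence_representatives (obs y).
rewrite -(p_match y J) //; last first.
  (* The set of representatives is nonempty, since it represents site 0. *)
  by have [j jJ _] := repJ (Ordinal n_gt0); apply/finset.set0Pn; exists j.
congr (P _); apply/seteqP; split=> omega Cs => [i j _ _ | i j]; first exact: Cs.
(* Each site has the same full observation as its representative, hence the same partial one, so
   agreement on [J] spreads to all sites. *)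
have [i' i'J /(star_obs y omega) ->] := repJ i.
by have [j' j'J /(star_obs y omega) ->] := repJ j; exact: Cs.
Qed.

Lemma partial_match_count_one_block (n : nat) (U : choiceType)
    (S : 'I_n -> {fset U}) (Omega : Type) (R : realType) (V : eqType)
    (star : tuples S -> Omega -> 'I_n -> V) (omega : Omega) :
  (0 < n)%N ->
  (partial_match_count star (one_block n) omega)%:R =
    \sum_(y : tuples S) \1_(all_coincide (star y)) omega :> R.
Proof.
move=> n_gt0; rewrite /partial_match_count -sum1_card natr_sum big_mkcond /=.
apply: eq_bigr => y _; rewrite inE indicE.
case: coincidence_one_blockP => // Cy; first by rewrite mem_set.
by rewrite memNset.
Qed.

Lemma sum_coincidence (n : nat) (U : choiceType) (S : 'I_n -> {fset U})
    (R : pzRingType) (f : {set {set 'I_n}} -> R) :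
  \sum_(y : tuples S) f (coincidence (obs y)) =
    \sum_(M in partitions n) f M * (match_count S M)%:R.
Proof.
rewrite (partition_big (fun y => coincidence (obs y)) (mem (partitions n))) /=.
  apply: eq_bigr => M _; rewrite (eq_bigr (fun=> f M)) => [|y /eqP-> //].
  by rewrite sumr_const mulr_natr /match_count cardsE.
by move=> y _; rewrite inE; exact: preim_partitionP.
Qed.

Lemma one_block_partition (n : nat) : (0 < n)%N -> one_block n \in partitions n.
Proof.
move=> n_gt0; rewrite inE /finset.partition finset.cover1 eqxx.
rewrite finset.trivIset1 inE /= eq_sym; apply/finset.set0Pn.
by exists (Ordinal n_gt0); rewrite inE.
Qed.

Lemma strictly_finer_one_block (n : nat) (M : {set {set 'I_n}}) :
  strictly_finer M (one_block n) = (M != one_block n).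
Proof.
rewrite /strictly_finer; suff -> : finer M (one_block n) by [].
apply/'forall_forallP => i j; apply/implyP => _.
by apply/exists_inP; exists [set: 'I_n]; rewrite ?inE.
Qed.

Theorem lemma21 (n : nat) (n_ge1 : (1 <= n)%N)
    (U : choiceType) (S : 'I_n -> {fset U})
    (d : measure_display) (Omega : measurableType d)
    (R : realType) (P : probability Omega R)
    (V : eqType) (star : tuples S -> Omega -> 'I_n -> V)
    (star_partial : partial_observation star)
    (p : nat -> R) (p_false_match : false_match_probabilities P star p) :
  unbiased_estimator P (match_estimator star p)
    (match_count S (one_block n))%:R.
Proof.
set c := \sum_(M in partitions n | strictly_finer M (one_block n))
           p #|M| * (match_count S M)%:R.
pose X omega : R := \sum_(y : tuples S) \1_(all_coincide (star y)) omega.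
have mE y : measurable (all_coincide (star y)).
  exact: measurable_all_coincide (star_partial.1 y).
(* The full data are fixed, so the subtracted sum is a constant random variable. *)
have estimatorE : match_estimator star p = X \- cst c.
  by apply/funext => omega; rewrite /match_estimator partial_match_count_one_block.
have XE : EFin \o X =
    (fun omega => \sum_(y : tuples S) (\1_(all_coincide (star y)) omega)%:E)%E.
  by apply/funext => omega; rewrite /= -sumEFin.
have iE y : P.-integrable [set: Omega]%classic
    (fun omega => (\1_(all_coincide (star y)) omega : R)%:E).
  exact: integrable_indic.
have iX : P.-integrable [set: Omega]%classic (EFin \o X).
  by rewrite XE; apply: integrable_sum.
have ic : P.-integrable [set: Omega]%classic (EFin \o cst c).
  exact: finite_measure_integrable_cst.
have EX : 'E_P[X]%E = (c + (match_count S (one_block n))%:R)%:E.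
  (* The integrand is refolded as a composition with [EFin] so that [XE] turns it into a sum of
     extended reals, over which the integral distributes. *)
  rewrite unlock; under eq_integral do rewrite -[(X _)%:E]/((EFin \o X) _) XE.
  rewrite integral_sum //.
  rewrite (eq_bigr (fun y => (p #|coincidence (obs y)|)%:E)) => [|y _]; last first.
    rewrite integral_indic // setIT.
    exact: probability_all_coincide n_ge1 star_partial p_false_match.
  rewrite sumEFin (sum_coincidence S (fun M => p #|M|)).
  (* The one-block term has coefficient [p 1 = 1]; the remaining partitions are exactly the strictly
     finer ones, which sum to [c]. *)
  rewrite (bigD1 (one_block n)) ?one_block_partition //= cards1 p_false_match.1.
  rewrite mul1r addrC /c; congr (_ + _)%:E; apply: eq_bigl => M.
  by rewrite strictly_finer_one_block.
rewrite /unbiased_estimator estimatorE; split.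
  exact: (integrableB measurableT iX ic).
rewrite expectationB; [|exact/Lfun1_integrable|exact/Lfun1_integrable].
by rewrite EX expectation_cst -EFinB addrAC subrr add0r.
Qed.
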